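(* Let $(\mathfrak{g},[\,,\,],\langle\,,\,\rangle)$ be a Lorentzian flat Lie algebra with center $Z(\mathfrak{g})$. Then $$Z(\mathfrak{g})=N_\ell(\mathfrak{g})\cap N_r(\mathfrak{g})\subset\mathfrak{L}(\mathfrak{g})=(\mathfrak{g}\mathfrak{g})^\perp\subset\mathfrak{D}(\mathfrak{g})^\perp .$$ Thus $Z(\mathfrak{g})$ and $Z(\mathfrak{g})^\perp$ are ideals of the Lie algebra $\mathfrak{g}$ and two-sided ideals of $\mathfrak{g}$ endowed with the Levi-Civita product. In particular, if $Z(\mathfrak{g})$ is nondegenerate, then $\mathfrak{g}=Z(\mathfrak{g})\oplus Z(\mathfrak{g})^\perp$, and both $Z(\mathfrak{g})$ and $Z(\mathfrak{g})^\perp$ are flat when endowed with the restricted metric.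
   Context: All Lie algebras are real and finite-dimensional. A Lorentzian Lie algebra is a Lie algebra $\mathfrak{g}$ with a nondegenerate symmetric bilinear form $\langle\,,\,\rangle$ of signature $(-,+,\dots,+)$. The Levi-Civita product $(u,v)\mapsto uv$ is defined by $2\langle uv,w\rangle=\langle[u,v],w\rangle+\langle[w,u],v\rangle+\langle[w,v],u\rangle$; $\mathrm{L}_uv=uv$, $\mathrm{R}_uv=vu$. The algebra (with any nondegenerate symmetric form) is flat if $\mathrm{L}_{[u,v]}=[\mathrm{L}_u,\mathrm{L}_v]$ for all $u,v\in\mathfrak{g}$. Notation: $N_\ell(\mathfrak{g})=\{u:\mathrm{L}_u=0\}$, $N_r(\mathfrak{g})=\{u:\mathrm{R}_u=0\}$, $\mathfrak{L}(\mathfrak{g})=\{u:\mathrm{ad}_u+\mathrm{ad}_u^*=0\}$ (adjoints with respect to $\langle\,,\,\rangle$), $\mathfrak{D}(\mathfrak{g})=[\mathfrak{g},\mathfrak{g}]$, and $\mathfrak{g}\mathfrak{g}$ is the span of all Levi-Civita products $uv$. $\perp$ denotes the orthogonal with respect to $\langle\,,\,\rangle$; a subspace is nondegenerate if the restriction of $\langle\,,\,\rangle$ to it is nondegenerate. *)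

(* Defs.v *)
From HB Require Import structures.
From mathcomp Require Import all_boot all_order all_algebra sesquilinear.
From mathcomp Require Import reals.
From mathcomp Require Import ring lra.

Set Implicit Arguments.
Unset Strict Implicit.
Unset Printing Implicit Defensive.

Import Order.TTheory GRing.Theory Num.Theory.
Local Open Scope ring_scope.

Record lieAlgebra (R : realType) (V : vectType R) := LieAlgebra {
  lie_bracket :> {bilinear V -> V -> V};
  lie_alternating : forall x, lie_bracket x x = 0;
  lie_jacobi : forall x y z,
    lie_bracket x (lie_bracket y z) + lie_bracket y (lie_bracket z x)
      + lie_bracket z (lie_bracket x y) = 0 }.

Section Subspaces.
Variables (R : realType) (V : vectType R).

(* The subspace spanned by the values of [m] on pairs of basis vectors; for a
   bilinear [m] this is the span of all its values, see [prod_spanP]. *)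
Definition prod_span (m : V -> V -> V) : {vspace V} :=
  <<[seq m x y | x <- vbasis fullv, y <- vbasis fullv]>>%VS.

Lemma prod_spanP (m : {bilinear V -> V -> V}) (W : {vspace V}) :
  reflect (forall x y, m x y \in W) (prod_span m <= W)%VS.
Proof.
apply: (iffP idP) => [sW x y|mW]; last first.
  by apply/span_subvP => _ /allpairsP[[x y] [_ _ ->]].
apply: (subvP sW); rewrite (coord_vbasis (memvf x)) (coord_vbasis (memvf y)).
rewrite linear_sumlz; apply: rpred_sum => i _.
rewrite linear_sumr; apply: rpred_sum => j _.
rewrite linearZl_LR linearZr_LR /=; do 2!apply: rpredZ.
by apply/memv_span/allpairsP; exists ((vbasis fullv)`_i, (vbasis fullv)`_j);
  split=> //; apply/mem_nth; rewrite size_tuple.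
Qed.

(* For a Lie bracket this is the usual notion, by antisymmetry. *)
Definition two_sided_ideal (m : V -> V -> V) (U : {vspace V}) : Prop :=
  forall x u, u \in U -> m x u \in U /\ m u x \in U.

Definition lie_subalgebra (g : lieAlgebra V) (U : {vspace V}) : Prop :=
  {in U &, forall x y, g x y \in U}.

End Subspaces.

Section LieNotions.
Variables (R : realType) (V : vectType R) (g : lieAlgebra V).

Definition ad (u : V) : 'End(V) := linfun (g u).

Lemma adE u v : ad u v = g u v. Proof. by rewrite lfunE. Qed.

Fact ad_linear : linear ad.
Proof.
move=> a u v; apply/lfunP => w.
by rewrite add_lfunE scale_lfunE !adE linearDl linearZl_LR.
Qed.
HB.instance Definition _ := GRing.isLinear.Build R V 'End(V) *:%R ad ad_linear.

Definition center : {vspace V} := lker (linfun ad).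

Lemma centerP u : reflect (forall v, g u v = 0) (u \in center).
Proof.
rewrite memv_ker lfunE; apply: (iffP eqP) => /= [ad0 v|gu0].
  by rewrite -adE ad0 lfunE.
by apply/lfunP => v; rewrite adE gu0 lfunE.
Qed.

Definition derived : {vspace V} := prod_span g.

End LieNotions.

Section Forms.
Variables (R : realType) (V : vectType R) (B : {symmetric V}).

(* Signature (-,+,...,+), in the sense of Sylvester; in particular the
   dimension is at least 1. *)
Definition lorentzian : Prop :=
  exists (n : nat) (e : n.+1.-tuple V), basis_of fullv e /\
    forall i j : 'I_n.+1, B (tnth e i) (tnth e j) =
      if i == j then (if i == ord0 then -1 else 1) else 0.

Lemma symmE x y : B x y = B y x.
Proof. by rewrite (@hermitian_subproof _ _ false idfun B x y) expr0 mul1r. Qed.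

Lemma nondegenerateP :
  reflect (forall u, (forall v, B u v = 0) -> u = 0) (nondegenerate B).
Proof.
apply: (iffP idP) => [/eqP nd u Bu|nd].
  by apply/eqP; rewrite -memv0 -nd; apply/mem_orthovP.
apply/eqP/vspaceP => u; rewrite memv0; apply/idP/eqP => [/mem_orthovP Bu|->].
  by apply: nd => v; apply: Bu; rewrite memvf.
exact: mem0v.
Qed.

Lemma lorentzian_nondegenerate : lorentzian -> nondegenerate B.
Proof.
case=> n [e [be Be]]; apply/nondegenerateP => u Bu.
rewrite (coord_basis be (memvf u)) big1 // => i _.
suff -> : coord e i u = 0 by rewrite scale0r.
have := Bu (tnth e i); rewrite {1}(coord_basis be (memvf u)) linear_sumlz.
rewrite (bigD1 i) //= big1 => [|j jNi]; rewrite linearZl_LR /= -tnth_nth Be.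
  rewrite eqxx addr0; case: ifP => _; lra.
by rewrite (negPf jNi) mulr0.
Qed.

(* The functional [v |-> <u, v>], valued in [R^o]. *)
Definition pairing (u : V) : 'Hom(V, R^o) := linfun (applyr B u : V -> R^o).

Lemma pairingE u v : pairing u v = B u v.
Proof. by rewrite lfunE /= symmE. Qed.

Fact pairing_linear : linear pairing.
Proof.
move=> a u v; apply/lfunP => w.
by rewrite add_lfunE scale_lfunE !pairingE linearDl linearZl_LR.
Qed.
HB.instance Definition _ :=
  GRing.isLinear.Build R V 'Hom(V, R^o) *:%R pairing pairing_linear.

Definition musical : 'Hom(V, 'Hom(V, R^o)) := linfun pairing.

Lemma musicalE u v : musical u v = B u v.
Proof. by rewrite lfunE /= pairingE. Qed.

(* The vector representing a linear functional, see [rieszP]. *)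
Definition riesz (phi : 'Hom(V, R^o)) : V := (musical^-1)%VF phi.

Lemma rieszP (phi : 'Hom(V, R^o)) : nondegenerate B ->
  forall w, B (riesz phi) w = phi w.
Proof.
move=> /nondegenerateP nd w; rewrite -musicalE /riesz.
have ker0 : lker musical == 0%VS.
  apply/eqP/vspaceP => u; rewrite memv_ker memv0.
  apply/eqP/eqP => [Bu0|->]; last by rewrite linear0.
  by apply: nd => v; rewrite -musicalE Bu0 lfunE.
rewrite limg_lfunVK //.
suff -> : limg musical = fullv by rewrite memvf.
apply/eqP; rewrite eqEdim subvf /= limg_dim_eq ?(eqP ker0) ?capv0 //.
by rewrite !dimvf /dim /= muln1.
Qed.

Definition adjoint_fun (f : 'End(V)) (w : V) : V := riesz (pairing w \o f)%VF.

Fact adjoint_fun_linear f : linear (adjoint_fun f).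
Proof.
by move=> a x y; rewrite /adjoint_fun linearP comp_lfunDl -comp_lfunZl /riesz linearP.
Qed.
HB.instance Definition _ f :=
  GRing.isLinear.Build R V V *:%R (adjoint_fun f) (@adjoint_fun_linear f).

Definition adjoint (f : 'End(V)) : 'End(V) := linfun (adjoint_fun f).

Lemma adjointP (f : 'End(V)) : nondegenerate B ->
  forall v w, B (f v) w = B v (adjoint f w).
Proof.
move=> nd v w; rewrite symmE [RHS]symmE lfunE /= rieszP //.
by rewrite comp_lfunE pairingE.
Qed.

Fact adjoint_linear : linear adjoint.
Proof.
move=> a f h; apply/lfunP => w.
rewrite add_lfunE scale_lfunE !lfunE /= /adjoint_fun.
by rewrite comp_lfunDr -comp_lfunZr /riesz linearP.
Qed.
HB.instance Definition _ :=
  GRing.isLinear.Build R 'End(V) 'End(V) *:%R adjoint adjoint_linear.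

End Forms.

Section LeviCivita.
Variables (R : realType) (V : vectType R).
Variables (g : lieAlgebra V) (B : {symmetric V}).

(* Half the right-hand side of the Koszul formula. *)
Definition koszul (u v w : V) : R^o :=
  2^-1 * (B (g u v) w + B (g w u) v + B (g w v) u).

Fact koszul_linear u v : linear (koszul u v).
Proof.
move=> a x y; rewrite /koszul !(linearDl, linearDr, linearZl_LR, linearZr_LR) /=.
by rewrite /GRing.scale /=; ring.
Qed.
HB.instance Definition _ u v :=
  GRing.isLinear.Build R V R^o *:%R (koszul u v) (@koszul_linear u v).

Definition levi_civita_fun (u v : V) : V := riesz B (linfun (koszul u v)).

Fact levi_civita_bilinear : bilinear_for *:%R *:%R levi_civita_fun.
Proof.
split=> [v a x y|u a x y]; rewrite /levi_civita_fun /riesz -linearP; congr (_ _);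
  apply/lfunP => w; rewrite add_lfunE scale_lfunE !lfunE /= /koszul;
  rewrite !(linearDl, linearDr, linearZl_LR, linearZr_LR) /=;
  by rewrite /GRing.scale /=; ring.
Qed.
HB.instance Definition _ :=
  bilinear_isBilinear.Build R V V V *:%R *:%R levi_civita_fun
    levi_civita_bilinear.

(* The product [(u, v) |-> uv], see [levi_civitaP]. *)
Definition levi_civita : {bilinear V -> V -> V} := levi_civita_fun.

Lemma levi_civitaP u v : nondegenerate B -> forall w,
  2 * B (levi_civita u v) w = B (g u v) w + B (g w u) v + B (g w v) u.
Proof.
move=> nd w; rewrite /levi_civita /= /levi_civita_fun rieszP // lfunE /= /koszul mulrA.
by rewrite mulfV ?pnatr_eq0 // mul1r.
Qed.

Definition Lmul (u : V) : 'End(V) := linfun (levi_civita u).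
Definition Rmul (u : V) : 'End(V) := linfun (levi_civita^~ u).

Lemma LmulE u v : Lmul u v = levi_civita u v. Proof. by rewrite lfunE. Qed.
Lemma RmulE u v : Rmul u v = levi_civita v u.
Proof. exact: (lfunE (applyr levi_civita u)). Qed.

Fact Lmul_linear : linear Lmul.
Proof.
move=> a u v; apply/lfunP => w.
by rewrite add_lfunE scale_lfunE !LmulE linearDl linearZl_LR.
Qed.
Fact Rmul_linear : linear Rmul.
Proof.
move=> a u v; apply/lfunP => w.
by rewrite add_lfunE scale_lfunE !RmulE linearDr linearZr_LR.
Qed.
HB.instance Definition _ := GRing.isLinear.Build R V 'End(V) *:%R Lmul Lmul_linear.
HB.instance Definition _ := GRing.isLinear.Build R V 'End(V) *:%R Rmul Rmul_linear.

(* Meaningful only when [B] is nondegenerate, like all notions built on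
   [levi_civita] and [adjoint]. *)
Definition flat : Prop :=
  forall u v, Lmul (g u v) = (Lmul u \o Lmul v)%VF - (Lmul v \o Lmul u)%VF.

(* The spaces of [u] with [L_u = 0], resp. [R_u = 0]. *)
Definition Nl : {vspace V} := lker (linfun Lmul).
Definition Nr : {vspace V} := lker (linfun Rmul).

Lemma NlP u : reflect (Lmul u = 0) (u \in Nl).
Proof. by rewrite memv_ker lfunE; apply: eqP. Qed.
Lemma NrP u : reflect (Rmul u = 0) (u \in Nr).
Proof. by rewrite memv_ker lfunE; apply: eqP. Qed.

Definition ad_sym (u : V) : 'End(V) := ad g u + adjoint B (ad g u).

Fact ad_sym_linear : linear ad_sym.
Proof. by move=> a u v; rewrite /ad_sym !linearP scalerDr addrACA. Qed.
HB.instance Definition _ :=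
  GRing.isLinear.Build R V 'End(V) *:%R ad_sym ad_sym_linear.

(* The space of [u] with [ad_u + ad_u^* = 0]. *)
Definition skew_ad : {vspace V} := lker (linfun ad_sym).

Lemma skew_adP u : reflect (ad g u + adjoint B (ad g u) = 0) (u \in skew_ad).
Proof. by rewrite memv_ker lfunE; apply: eqP. Qed.

Definition products : {vspace V} := prod_span levi_civita.

End LeviCivita.

Section Restriction.
Variables (R : realType) (V : vectType R) (U : {vspace V}).

Definition restr_form_fun (B : {symmetric V}) (x y : subvs_of U) : R :=
  B (vsval x) (vsval y).

Section FormInstance.
Variable B : {symmetric V}.

Fact restr_form_bilinear :
  bilinear_for *%R (idfun \; *%R) (restr_form_fun B).
Proof.
split=> [y a x x'|x a y y']; rewrite /restr_form_fun [vsval (_ + _)]linearP.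
  by rewrite linearDl linearZl_LR.
by rewrite linearDr linearZr_LR.
Qed.
HB.instance Definition _ := bilinear_isBilinear.Build R (subvs_of U) (subvs_of U)
  R *%R (idfun \; *%R) (restr_form_fun B) restr_form_bilinear.

Fact restr_form_symmetric x y :
  restr_form_fun B x y = (-1) ^+ false * idfun (restr_form_fun B y x).
Proof. by rewrite expr0 mul1r /restr_form_fun symmE. Qed.
HB.instance Definition _ := isHermitianSesquilinear.Build R (subvs_of U)
  false idfun (restr_form_fun B) restr_form_symmetric.
End FormInstance.

Definition restr_form (B : {symmetric V}) : {symmetric (subvs_of U)} :=
  restr_form_fun B.

(* [vsproj U] only matters when [U] is not a subalgebra, see [restr_bracketE]. *)
Definition restr_bracket_fun (g : lieAlgebra V) (x y : subvs_of U) : subvs_of U :=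
  vsproj U (g (vsval x) (vsval y)).

Section BracketInstance.
Variable g : lieAlgebra V.

Fact restr_bracket_bilinear : bilinear_for *:%R *:%R (restr_bracket_fun g).
Proof.
split=> [y a x x'|x a y y']; rewrite /restr_bracket_fun [vsval (_ + _)]linearP.
  by rewrite linearDl linearZl_LR linearP.
by rewrite linearDr linearZr_LR linearP.
Qed.
HB.instance Definition _ := bilinear_isBilinear.Build R (subvs_of U) (subvs_of U)
  (subvs_of U) *:%R *:%R (restr_bracket_fun g) restr_bracket_bilinear.
End BracketInstance.

Variables (g : lieAlgebra V) (hU : lie_subalgebra g U).

Lemma restr_bracketE x y :
  vsval (restr_bracket_fun g x y) = g (vsval x) (vsval y).
Proof. by rewrite /restr_bracket_fun vsprojK // hU ?subvsP. Qed.

Fact restr_alternating x : restr_bracket_fun g x x = 0.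
Proof. by rewrite /restr_bracket_fun lie_alternating linear0. Qed.

Fact restr_jacobi x y z :
  restr_bracket_fun g x (restr_bracket_fun g y z)
    + restr_bracket_fun g y (restr_bracket_fun g z x)
    + restr_bracket_fun g z (restr_bracket_fun g x y) = 0.
Proof.
by apply: subvs_inj; rewrite !linearD /= !restr_bracketE lie_jacobi.
Qed.

Definition restr_lie : lieAlgebra (subvs_of U) :=
  @LieAlgebra R (subvs_of U) (restr_bracket_fun g) restr_alternating restr_jacobi.

End Restriction.

(* Main.v *)
Require Import Defs.
From mathcomp Require Import all_boot all_order all_algebra sesquilinear reals.
From mathcomp Require Import ring lra.

Set Implicit Arguments.
Unset Strict Implicit.
Unset Printing Implicit Defensive.

Import GRing.Theory Num.Theory.
Local Open Scope ring_scope.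

(** The heart of the matter is [skew_ad_eq_Nr]: [ad_u] is skew exactly when
    [R_u = 0].

    If [ad_u] is skew, then so is [R_u = L_u - ad_u], because left
    multiplications are skew ([levi_civita_skew]), and [uu = 0].  Flatness
    evaluated at the triple [(v, u, u)] then reads [R_u ^ 2 = [R_u, L_u]].  The
    left side is symmetric, as the square of a skew map, and the right side is
    skew, as the commutator of two skew maps; hence [R_u ^ 2 = 0]
    ([skew_ad_Rmul_nilpotent]).  A skew map of square zero has a totally
    isotropic image, which in Lorentzian signature is at most a line, whereas a
    skew map has even rank; so [R_u = 0] ([lorentzian_skew_square0]).

    The rest is formal.  Since each [L_v] is skew, [R_u = 0] means that [u] is
    orthogonal to all products [vw] ([Nr_orthov_products]).  A central [z] has
    [ad_z = 0], which is skew, so [R_z = 0] and then [L_z = ad_z + R_z = 0]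
    ([center_eq]).  Consequently products and brackets with a central factor
    vanish, and the orthogonal of the center contains all products and all
    brackets [[u, v] = uv - vu], which gives the ideals.
    When the center is nondegenerate, the Koszul formula shows that the
    Levi-Civita product of each factor is the restricted one, and flatness
    restricts with it ([restr_flat]). *)

(** * Skew maps in Lorentzian signature *)

Section SymmetricForm.
Variables (R : realType) (V : vectType R) (B : {symmetric V}).

Lemma form_eqP : nondegenerate B ->
  forall u v, (forall w, B u w = B v w) -> u = v.
Proof.
move=> /nondegenerateP nd u v Buv; apply/eqP; rewrite -subr_eq0; apply/eqP.
by apply: nd => w; rewrite linearBl /= Buv subrr.
Qed.

(** Orthogonally to a timelike vector the form is positive definite: there the
    norm of [v] is the sum of the squares of its coordinates. *)
Lemma lorentzian_time_axis : lorentzian B ->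
  exists e, forall v, B v v = 0 -> B v e = 0 -> v = 0.
Proof.
case=> n [e [be Be]]; exists (tnth e ord0) => v.
have Bei (i : 'I_n.+1) :
    B v (tnth e i) = coord e i v * (if i == ord0 then -1 else 1).
  rewrite {1}(coord_basis be (memvf v)) linear_sumlz (bigD1 i) //= big1.
    by rewrite addr0 linearZl_LR /= -tnth_nth Be eqxx.
  by move=> j jNi; rewrite linearZl_LR /= -tnth_nth Be (negPf jNi) mulr0.
rewrite Bei eqxx mulrN1 => Bvv /eqP; rewrite oppr_eq0 => /eqP c0.
have {}Bvv : \sum_(i < n.+1) coord e i v ^+ 2 = 0.
  rewrite -[RHS]Bvv {3}(coord_basis be (memvf v)) linear_sumr.
  apply: eq_bigr => i _; rewrite linearZr_LR /= -tnth_nth Bei.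
  by case: eqP => [->|_]; rewrite ?c0 ?mul0r ?mulr1 ?expr2 ?mulr0.
rewrite (coord_basis be (memvf v)) big1 // => i _.
suff /eqP : coord e i v ^+ 2 = 0 by rewrite expf_eq0 => /eqP-> ; rewrite scale0r.
have /psumr_eq0P-> // := Bvv.
by move=> j _; apply: sqr_ge0.
Qed.

(** The image of [D] is totally isotropic, so any two of its vectors are
    proportional, the ratio being read off along the time axis.  Pairing this
    proportionality with [u] and using [<Du, u> = 0] leaves
    [<Du, e> <Du, v> = 0] for every [v]. *)
Lemma lorentzian_skew_square0 (D : 'End(V)) : lorentzian B ->
  (forall u v, B (D u) v = - B u (D v)) -> (forall v, D (D v) = 0) -> D = 0.
Proof.
move=> hB skewD D2; have /nondegenerateP nd := lorentzian_nondegenerate hB.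
have [e timeB] := lorentzian_time_axis hB.
have isoD u v : B (D u) (D v) = 0 by rewrite skewD D2 linear0r oppr0.
have parallel u v : B (D v) e *: D u = B (D u) e *: D v.
  apply/eqP; rewrite -subr_eq0; apply/eqP/timeB.
    by rewrite !(linearBl, linearBr, linearZl_LR, linearZr_LR) /= !isoD;
       rewrite !mulr0 !subr0.
  by rewrite linearBl !linearZl_LR /= mulrC subrr.
apply/lfunP => u; rewrite lfunE /=; apply: timeB => //.
apply/eqP/negPn/negP => Due; case/eqP: (Due).
suff -> : D u = 0 by rewrite linear0l.
apply: nd => v; apply: (mulfI Due); rewrite mulr0.
have := congr1 (B^~ u) (parallel u v).
have -> : B (D u) v = - B (D v) u by rewrite skewD symmE.
have Duu : B (D u) u = 0 by have := skewD u u; rewrite [B u _]symmE; lra.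
by rewrite !linearZl_LR /= Duu mulr0 mulrN => <-; rewrite oppr0.
Qed.

End SymmetricForm.

(** * The Levi-Civita product *)

Section LeviCivitaProduct.
Variables (R : realType) (V : vectType R) (g : lieAlgebra V) (B : {symmetric V}).

Lemma lie_anticomm u v : g u v = - g v u.
Proof.
apply/eqP; rewrite -addr_eq0; apply/eqP; have := lie_alternating g (u + v).
by rewrite linearDl !linearDr /= !lie_alternating add0r addr0.
Qed.

Lemma center_bracket z u : z \in center g -> g z u = 0 /\ g u z = 0.
Proof. by move=> /centerP gz; rewrite (lie_anticomm u) gz oppr0. Qed.

Hypothesis nd : nondegenerate B.

Lemma levi_civita_skew u v w :
  B (levi_civita g B u v) w = - B v (levi_civita g B u w).
Proof.
have := levi_civitaP g u v nd w; have := levi_civitaP g u w nd v.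
rewrite [B v (_ _)]symmE (lie_anticomm v u) (lie_anticomm w u).
by rewrite (lie_anticomm w v) !linearNl /=; lra.
Qed.

Lemma levi_civita_torsionfree u v :
  levi_civita g B u v - levi_civita g B v u = g u v.
Proof.
apply: (form_eqP nd) => w; rewrite linearBl /=.
have := levi_civitaP g u v nd w; have := levi_civitaP g v u nd w.
by rewrite (lie_anticomm v u) !linearNl /=; lra.
Qed.

Lemma skew_ad_formP u :
  reflect (forall v w, B (g u v) w = - B v (g u w)) (u \in skew_ad g B).
Proof.
apply: (iffP (skew_adP g B u)) => [sk v w | sk].
  rewrite -adE adjointP // -adE; move/lfunP/(_ w): sk.
  by rewrite add_lfunE zero_lfunE => /(canRL (addKr _)) ->; rewrite addr0 linearNr.
apply/lfunP => w; rewrite add_lfunE zero_lfunE; apply: (form_eqP nd) => v.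
by rewrite linearDl linear0l /= ![B _ v]symmE -adjointP // !adE sk addrN.
Qed.

(** Skewness of [ad_u] cancels two of the three Koszul terms of [vu], and what
    remains is alternating in [v] and [w]. *)
Lemma skew_ad_Rmul_form u v w : u \in skew_ad g B ->
  2 * B (levi_civita g B v u) w = B (g w v) u.
Proof.
move=> /skew_ad_formP sk; rewrite levi_civitaP //.
rewrite (lie_anticomm v u) (lie_anticomm w u) !linearNl /= sk [B v _]symmE.
by lra.
Qed.

Lemma skew_ad_Rmul_skew u v w : u \in skew_ad g B ->
  B (levi_civita g B v u) w = - B v (levi_civita g B w u).
Proof.
move=> sk; have := skew_ad_Rmul_form v w sk; have := skew_ad_Rmul_form w v sk.
by rewrite (lie_anticomm w v) linearNl /= [B v _]symmE; lra.
Qed.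

Lemma skew_ad_square0 u : u \in skew_ad g B -> levi_civita g B u u = 0.
Proof.
move=> sk; apply: (form_eqP nd) => w; rewrite linear0l.
have := skew_ad_Rmul_form u w sk; move/skew_ad_formP: sk => sk.
rewrite (lie_anticomm w u) linearNl /= sk lie_alternating linear0r; lra.
Qed.

(** [<vu, w> = - <u, vw>] by skewness of [L_v]. *)
Lemma Nr_orthov_products : Nr g B = orthov B (products g B).
Proof.
apply/vspaceP => u; apply/NrP/mem_orthovP => [Ru0 p|ort].
  suff /subvP sub : (products g B <= orthov B <[u]>)%VS.
    by move=> /sub; rewrite mem_orthov1 symmE => /eqP.
  apply/prod_spanP => v w; rewrite mem_orthov1 levi_civita_skew -RmulE Ru0.
  by rewrite lfunE linear0r oppr0.
apply/lfunP => v; rewrite lfunE RmulE /=; apply: (form_eqP nd) => w.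
rewrite levi_civita_skew ort ?oppr0 ?linear0l //.
by move: v w; apply/prod_spanP.
Qed.

Lemma derived_sub_products : (derived g <= products g B)%VS.
Proof.
apply/prod_spanP => u v; rewrite -levi_civita_torsionfree.
by apply: rpredB; [move: u v | move: v u]; apply/prod_spanP.
Qed.

Lemma Nl_Nr_sub_center : (Nl g B :&: Nr g B <= center g)%VS.
Proof.
apply/subvP => u; rewrite memv_cap => /andP[/NlP Lu0 /NrP Ru0].
apply/centerP => v; rewrite -levi_civita_torsionfree -LmulE -RmulE Lu0 Ru0.
by rewrite !lfunE subrr.
Qed.

Lemma center_sub_skew_ad : (center g <= skew_ad g B)%VS.
Proof.
apply/subvP => z /centerP gz; apply/skew_ad_formP => v w.
by rewrite !gz linear0l linear0r oppr0.
Qed.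

(** * Consequences of flatness *)

Hypothesis hflat : flat g B.

Lemma flatE u v w : levi_civita g B (g u v) w =
  levi_civita g B u (levi_civita g B v w) - levi_civita g B v (levi_civita g B u w).
Proof.
by have /lfunP/(_ w) := hflat u v;
   rewrite add_lfunE opp_lfunE !comp_lfunE !LmulE.
Qed.

(** [R_u ^ 2] is both symmetric and skew: flatness and [uu = 0] identify it with
    the commutator of the skew maps [R_u] and [L_u]. *)
Lemma skew_ad_Rmul_nilpotent u v : u \in skew_ad g B ->
  levi_civita g B (levi_civita g B v u) u = 0.
Proof.
set m := levi_civita g B => sk.
(* R_u R_u x = R_u L_u x - L_u R_u x *)
have commE x : m (m x u) u = m (m u x) u - m u (m x u).
  have := flatE x u u; rewrite -/m -levi_civita_torsionfree -/m.
  rewrite skew_ad_square0 // linear0r sub0r linearBl /=.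
  by move/(canRL (subrK _)) ->; rewrite addrC.
have skR x y : B (m x u) y = - B x (m y u) by apply: skew_ad_Rmul_skew.
have skL x y : B (m u x) y = - B x (m u y) by apply: levi_civita_skew.
apply: (form_eqP nd) => w; rewrite linear0l.
have sym : B (m (m v u) u) w = B v (m (m w u) u) by rewrite !skR opprK.
have : B (m (m v u) u) w = - B v (m (m w u) u).
  by rewrite !commE linearBl linearBr /= skR skL skL skR; ring.
by rewrite -sym; lra.
Qed.

(** The restricted product satisfies the Koszul formula of the restricted
    structure, which determines its Levi-Civita product since the restricted
    form is nondegenerate; the flatness identity is then inherited. *)
Lemma restr_flat (U : {vspace V}) (hU : lie_subalgebra g U) :
  nondegenerate (restr_form U B) ->
  {in U &, forall x y, levi_civita g B x y \in U} ->
  flat (restr_lie hU) (restr_form U B).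
Proof.
move=> ndU mU.
have lcE x y : vsval (levi_civita (restr_lie hU) (restr_form U B) x y) =
    levi_civita g B (vsval x) (vsval y).
  rewrite -[RHS](vsprojK (mU _ _ (subvsP x) (subvsP y))); congr vsval.
  apply: (form_eqP ndU) => w.
  apply: (mulfI (_ : 2 != 0)); first by rewrite pnatr_eq0.
  rewrite levi_civitaP // [in RHS]/restr_form /= /restr_form_fun.
  rewrite vsprojK ?mU ?subvsP // levi_civitaP //.
  by rewrite /restr_lie /= /restr_form_fun !restr_bracketE.
move=> x y; apply/lfunP => z; apply: subvs_inj.
rewrite add_lfunE opp_lfunE !comp_lfunE !LmulE linearB /= !lcE.
by rewrite restr_bracketE // flatE.
Qed.

End LeviCivitaProduct.

(** * Orthogonal splitting along a nondegenerate subspace *)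

Section NondegenerateSubspace.
Variables (R : realType) (V : vectType R) (B : {symmetric V}) (U : {vspace V}).
Hypothesis ndU : nondegenerate (restr_form U B).

Lemma nondegenerate_capv : (U :&: orthov B U)%VS = 0%VS.
Proof.
apply/eqP; rewrite -subv0; apply/subvP => u; rewrite memv_cap memv0.
case/andP=> uU /mem_orthovP Bu; move/nondegenerateP: ndU => nd.
apply/eqP; rewrite -(vsprojK uU); suff -> : vsproj U u = 0 by rewrite linear0.
apply: nd => w.
by rewrite /restr_form /= /restr_form_fun vsprojK // Bu ?subvsP.
Qed.

(** The orthogonal projection of [v] onto [U] is the vector of [U] representing
    the functional [<v, _>] restricted to [U]. *)
Lemma nondegenerate_addv : (U + orthov B U)%VS = fullv.
Proof.
apply/eqP; rewrite eqEsubv subvf /=; apply/subvP => v _.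
pose phi : 'Hom(subvs_of U, R^o) := (pairing B v \o linfun vsval)%VF.
pose p := vsval (riesz (restr_form U B) phi).
rewrite -(subrK p v) addrC memv_add ?subvsP //.
apply/mem_orthovP => w wU; rewrite linearBl /=.
have := rieszP phi ndU (vsproj U w).
rewrite /restr_form /= /restr_form_fun vsprojK // => ->.
by rewrite comp_lfunE pairingE lfunE /= vsprojK // subrr.
Qed.

Lemma nondegenerate_orthov : nondegenerate B ->
  nondegenerate (restr_form (orthov B U) B).
Proof.
move=> /nondegenerateP nd; apply/nondegenerateP => u Bu.
apply: subvs_inj; rewrite linear0; apply: nd => v.
have : v \in (U + orthov B U)%VS by rewrite nondegenerate_addv memvf.
case/memv_addP=> x xU [y yU ->]; rewrite linearDr /=.
have /mem_orthovP-> // := subvsP u.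
have := Bu (vsproj _ y); rewrite /restr_form /= /restr_form_fun vsprojK // => ->.
by rewrite addr0.
Qed.

End NondegenerateSubspace.

(** * Lorentzian flat Lie algebras *)

Section LorentzianFlat.
Variables (R : realType) (V : vectType R) (g : lieAlgebra V) (B : {symmetric V}).
Hypotheses (hB : lorentzian B) (hflat : flat g B).
Let nd : nondegenerate B := lorentzian_nondegenerate hB.

(** If [ad_u] is skew, then [R_u] is skew of square zero, hence zero; conversely,
    [R_u = 0] makes [ad_u] equal to the skew map [L_u]. *)
Lemma skew_ad_eq_Nr : skew_ad g B = Nr g B.
Proof.
apply/vspaceP => u; apply/idP/NrP => [sk|Ru0].
  apply: (lorentzian_skew_square0 hB) => [v w|v].
    by rewrite !RmulE; apply: skew_ad_Rmul_skew.
  by rewrite !RmulE; apply: skew_ad_Rmul_nilpotent.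
have adL v : g u v = levi_civita g B u v.
  by rewrite -(levi_civita_torsionfree g nd) -(RmulE g B u v) Ru0 lfunE subr0.
by apply/(skew_ad_formP _ nd) => v w; rewrite !adL levi_civita_skew.
Qed.

Lemma center_eq : center g = (Nl g B :&: Nr g B)%VS.
Proof.
apply/eqP; rewrite eqEsubv Nl_Nr_sub_center // andbT subv_cap.
have sub : (center g <= Nr g B)%VS by rewrite -skew_ad_eq_Nr center_sub_skew_ad.
rewrite sub andbT; apply/subvP => z zZ; have /NrP Rz0 := subvP sub _ zZ.
apply/NlP/lfunP => v; rewrite LmulE lfunE /=.
have [gz _] := center_bracket v zZ.
have := levi_civita_torsionfree g nd z v.
by rewrite gz -(RmulE g B z v) Rz0 lfunE subr0.
Qed.

Lemma center_levi_civita z u : z \in center g ->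
  levi_civita g B z u = 0 /\ levi_civita g B u z = 0.
Proof.
rewrite center_eq memv_cap => /andP[/NlP Lz0 /NrP Rz0].
by rewrite -LmulE -(RmulE g B z u) Lz0 Rz0 !lfunE.
Qed.

Lemma products_sub_orthov_center : (products g B <= orthov B (center g))%VS.
Proof.
by rewrite orthov_sym -Nr_orthov_products // center_eq capvSr.
Qed.

End LorentzianFlat.

Theorem mainTheorem2 (R : realType) (V : vectType R) (g : lieAlgebra V)
    (B : {symmetric V}) (hB : lorentzian B) (hflat : flat g B) :
  let Z := center g in
  let Zp := orthov B Z in
  [/\ Z = (Nl g B :&: Nr g B)%VS,
      (Nl g B :&: Nr g B <= skew_ad g B)%VS,
      skew_ad g B = orthov B (products g B)
    & (orthov B (products g B) <= orthov B (derived g))%VS] /\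
  [/\ two_sided_ideal g Z, two_sided_ideal g Zp,
      two_sided_ideal (levi_civita g B) Z
    & two_sided_ideal (levi_civita g B) Zp] /\
  (nondegenerate (restr_form Z B) ->
    [/\ (Z + Zp)%VS = fullv, (Z :&: Zp)%VS = 0%VS,
        nondegenerate (restr_form Zp B),
        exists hZ : lie_subalgebra g Z,
          flat (restr_lie hZ) (restr_form Z B)
      & exists hZp : lie_subalgebra g Zp,
          flat (restr_lie hZp) (restr_form Zp B)]).
Proof.
move=> Z Zp; have nd := lorentzian_nondegenerate hB.
have lcZp u v : levi_civita g B u v \in Zp.
  by move: u v; apply/prod_spanP; apply: products_sub_orthov_center.
have gZp u v : g u v \in Zp.
  by rewrite -(levi_civita_torsionfree g nd) rpredB.
have lcZ u v : u \in Z -> levi_civita g B u v \in Z.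
  by case/(center_levi_civita hB hflat v) => -> _; apply: mem0v.
have gZ u v : u \in Z -> g u v \in Z.
  by case/(center_bracket v) => -> _; apply: mem0v.
split; [split | split; [split | move=> ndZ; split]].
- exact: center_eq.
- by rewrite -center_eq // center_sub_skew_ad.
- by rewrite skew_ad_eq_Nr // Nr_orthov_products.
- by rewrite orthov_sym (subv_trans (derived_sub_products g nd)) // orthov_sym.
- by move=> x u /[dup] /gZ -> /(center_bracket x)[_ ->]; rewrite mem0v.
- by move=> x u _.
- move=> x u /[dup] /lcZ -> /(center_levi_civita hB hflat x)[_ ->].
  by rewrite mem0v.
- by move=> x u _.
- exact: nondegenerate_addv.
- exact: nondegenerate_capv.
- exact: nondegenerate_orthov.
- have hZ : lie_subalgebra g Z by move=> x y /gZ.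
  by exists hZ; apply: restr_flat => // x y /lcZ.
- have hZp : lie_subalgebra g Zp by move=> x y.
  by exists hZp; apply: restr_flat => //; apply: nondegenerate_orthov.
Qed.
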